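(* The braided Hopf algebra $D$ in the braided tensor category $\mathcal{D}$ is braided cocommutative: its opposite coproduct $\Delta^{op}$ equals its coproduct $\Delta$. Here $\Delta^{op}:D\to D\otimes D$ is the map characterized by the property that, for all representations $V,W$ of $D$ (objects of $\mathcal{D}$), the action of $D$ on $V\otimes W$ formed with $\Delta^{op}$ in place of $\Delta$ equals $$\Psi_{V,W}^{-1}\circ \alpha_{W\otimes V}\circ(\Psi_{V,W}\otimes \mathrm{id}_D):(V\otimes W)\otimes D\to V\otimes W,$$ where $\alpha_{W\otimes V}$ is the action of $D$ on $W\otimes V$ formed with $\Delta$.
   Context: $X$ is a finite group with identity $e$, $G\subset X$ a subgroup, and $M\subset X$ a set of coset representatives with $e\in M$: every $x\in X$ factors uniquely as $x=us$ with $u\in G$, $s\in M$. For $s,t\in M$, $u\in G$ define $\tau(s,t),\,s\triangleright u\in G$ and $s\cdot t,\,s\triangleleft u\in M$ by $st=\tau(s,t)(s\cdot t)$ and $su=(s\triangleright u)(s\triangleleft u)$. It is assumed that $(M,\cdot)$ has left division: for all $s,p\in M$ there is a unique $t\in M$ with $s\cdot t=p$. All vector spaces are finite dimensional over a field $k$. For $y,x\in X$ put $y\tilde\triangleleft x=x^{-1}yx$. For $v,w\in G$, $t,p\in M$ put $(vt)\circ(wp)=wvtp$, $\tilde\tau(vt,wp)=\tau(t,p)$, and $vt\,\tilde\triangleright\, wp=v^{-1}wpv'=twpt'^{-1}$, where $vt\,\tilde\triangleleft\, wp=v't'$ with $v'\in G$, $t'\in M$. Objects of $\mathcal{D}$: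 $X$-graded vector spaces with right $X$-action $\hat\triangleleft$ such that $\|\xi\hat\triangleleft x\|=\|\xi\|\tilde\triangleleft x$, where $\|\xi\|\in X$ is the grade of a homogeneous $\xi$, and $|\xi|\in G$, $\langle\xi\rangle\in M$ are defined by $\|\xi\|=|\xi|^{-1}\langle\xi\rangle$. Morphisms: linear maps preserving grade and action. Tensor product: $\|\xi\otimes\eta\|=\|\xi\|\circ\|\eta\|$, $(\xi\otimes\eta)\hat\triangleleft x=\xi\hat\triangleleft(\|\eta\|\tilde\triangleright x)\otimes\eta\hat\triangleleft x$. Associator: $\Phi((\xi\otimes\eta)\otimes\zeta)=\xi\hat\triangleleft\tau(\langle\eta\rangle,\langle\zeta\rangle)\otimes(\eta\otimes\zeta)$. Braiding: $\Psi(\xi\otimes\eta)=\eta\hat\triangleleft(\langle\xi\rangle\triangleleft|\eta|)^{-1}\otimes\xi\hat\triangleleft|\eta|$. The algebra $D$ has basis $\delta_y\otimes x$ ($x,y\in X$), grade given by $y\circ\|\delta_y\otimes x\|=y\tilde\triangleleft x$, $X$-action $(\delta_y\otimes x)\hat\triangleleft z=\delta_{y\tilde\triangleleft(a\tilde\triangleright z)}\otimes(a\tilde\triangleright z)^{-1}xz$ and product $(\delta_y\otimes x)(\delta_w\otimes z)=\delta_{w,y\tilde\triangleleft x}\,\delta_{y\tilde\triangleleft\tilde\tau(a,b)}\otimes\tilde\tau(a,b)^{-1}xz$, where $a=\|\delta_y\otimes x\|$, $b=\|\delta_w\otimes z\|$. Every object $V$ of $\mathcal{D}$ is a right representation of $D$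 via the morphism $\alpha_V:V\otimes D\to V$, $\alpha_V(\xi\otimes(\delta_y\otimes x))=\delta_{y,\|\xi\|}\,\xi\hat\triangleleft x$. For a map $\Delta':D\to D\otimes D$ in $\mathcal{D}$, the action of $D$ on $V\otimes W$ formed with $\Delta'$ is the composite $$(V\otimes W)\otimes D\xrightarrow{\mathrm{id}\otimes\Delta'}(V\otimes W)\otimes(D\otimes D)\cong V\otimes((W\otimes D)\otimes D)\xrightarrow{\Psi_{W,D}}V\otimes((D\otimes W)\otimes D)\cong(V\otimes D)\otimes(W\otimes D)\xrightarrow{\alpha_V\otimes\alpha_W}V\otimes W,$$ the isomorphisms being built from the associator. The coproduct $\Delta$ of the braided Hopf algebra $D$ is characterized by the property that, for all objects $V,W$, this composite with $\Delta'=\Delta$ is the action $\alpha_{V\otimes W}$ of the object $V\otimes W$. *)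

(* Defs.v *)
From HB Require Import structures.
From mathcomp Require Import all_boot all_order all_algebra all_fingroup.

Set Implicit Arguments.
Unset Strict Implicit.
Unset Printing Implicit Defensive.

Import GRing.Theory.
Local Open Scope ring_scope.

(* Tensor product of finite dimensional spaces, as the space of coordinate
   matrices; [tliftE] and [tens_ext] together are its universal property. *)
Section Tensor.
Variable k : fieldType.

Definition tens (V W : vectType k) : vectType k :=
  'M[k]_(\dim {:V}, \dim {:W}).

Definition tv (V W : vectType k) (v : V) (w : W) : tens V W :=
  \matrix_(i, j) (coord (vbasis {:V}) i v * coord (vbasis {:W}) j w).

Definition tlift (V W U : vectType k) (b : V -> W -> U) : 'Hom(tens V W, U) :=
  linfun (fun A : tens V W =>
    \sum_i \sum_j A i j *: b (vbasis {:V})`_i (vbasis {:W})`_j).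

Definition tmap (V V' W W' : vectType k) (f : 'Hom(V, V')) (g : 'Hom(W, W')) :
    'Hom(tens V W, tens V' W') :=
  tlift (fun v w => tv (f v) (g w)).

Definition bilin (V W U : vectType k) (b : V -> W -> U) : Prop :=
  (forall w, linear (b^~ w)) /\ (forall v, linear (b v)).

Definition tvs (V W : vectType k) (A : {vspace V}) (B : {vspace W}) :
    {vspace tens V W} :=
  <<[seq tv v w | v <- vbasis A, w <- vbasis B]>>%VS.

Section Theory.
Variables V W U : vectType k.

Lemma lin_sum (U1 U2 : vectType k) (f : U1 -> U2) (I : finType) (c : I -> k)
    (u : I -> U1) :
  linear f -> f (\sum_i c i *: u i) = \sum_i c i *: f (u i).
Proof.
move=> lf.
have f0 : f 0 = 0.
  by have := lf (-1) 0 0; rewrite scaler0 addr0 scaleN1r addNr.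
have fZ c1 u1 : f (c1 *: u1) = c1 *: f u1.
  by rewrite -[c1 *: u1]addr0 lf f0 addr0.
have fD u1 u2 : f (u1 + u2) = f u1 + f u2.
  by rewrite -[u1 in LHS]scale1r lf scale1r.
by rewrite (big_morph f fD f0); apply: eq_bigr => i _; rewrite fZ.
Qed.

Lemma tv_bilin : bilin (@tv V W).
Proof.
split=> [w a v v' | v a w w']; apply/matrixP=> i j; rewrite !mxE linearP /=.
  by rewrite mulrDl mulrA.
by rewrite mulrDr mulrCA.
Qed.

Lemma tlift_linear (b : V -> W -> U) :
  linear (fun A : tens V W =>
    \sum_i \sum_j A i j *: b (vbasis {:V})`_i (vbasis {:W})`_j).
Proof.
move=> a A B; rewrite scaler_sumr -big_split; apply: eq_bigr => i _ /=.
rewrite scaler_sumr -big_split; apply: eq_bigr => j _ /=.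
by rewrite !mxE scalerDl scalerA.
Qed.

Lemma tlift_def (b : V -> W -> U) (A : tens V W) :
  tlift b A = \sum_i \sum_j A i j *: b (vbasis {:V})`_i (vbasis {:W})`_j.
Proof.
pose F := GRing.isLinear.Build _ _ _ _ _ (tlift_linear b).
pose f : {linear tens V W -> U} := HB.pack (fun A : tens V W =>
  \sum_i \sum_j A i j *: b (vbasis {:V})`_i (vbasis {:W})`_j) F.
exact: (lfunE f).
Qed.

Lemma tliftE (b : V -> W -> U) v w : bilin b -> tlift b (tv v w) = b v w.
Proof.
move=> [bl br]; rewrite tlift_def.
rewrite {2}(coord_vbasis (memvf v)) {2}(coord_vbasis (memvf w)).
rewrite (lin_sum _ _ (bl _)); apply: eq_bigr => i _.
rewrite (lin_sum _ _ (br _)) scaler_sumr; apply: eq_bigr => j _.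
by rewrite mxE scalerA.
Qed.

Lemma tens_span (A : tens V W) :
  A = \sum_i \sum_j A i j *: tv (vbasis {:V})`_i (vbasis {:W})`_j.
Proof.
apply/matrixP=> i j; rewrite summxE (bigD1 i) //= summxE (bigD1 j) //=.
rewrite !mxE !coord_free ?(basis_free (vbasisP _)) // !eqxx !mulr1.
rewrite big1 => [|j' ne]; last first.
  by rewrite !mxE !coord_free ?(basis_free (vbasisP _)) // (negbTE ne) !mulr0.
rewrite addr0 big1 ?addr0 // => i' ne; rewrite summxE big1 // => j' _.
by rewrite !mxE !coord_free ?(basis_free (vbasisP _)) //
   (negbTE ne) mul0r mulr0.
Qed.

Lemma tens_ext (f g : 'Hom(tens V W, U)) :
  (forall v w, f (tv v w) = g (tv v w)) -> f = g.
Proof.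
move=> fg; apply/lfunP=> A; rewrite (tens_span A) !linear_sum.
apply: eq_bigr => i _; rewrite !linear_sum; apply: eq_bigr => j _.
by rewrite !linearZ /= fg.
Qed.

Lemma mem_tvs (A : {vspace V}) (B : {vspace W}) v w :
  v \in A -> w \in B -> tv v w \in tvs A B.
Proof.
move=> /coord_vbasis -> /coord_vbasis ->.
rewrite (lin_sum _ _ (tv_bilin.1 _)); apply: rpred_sum => i _.
rewrite (lin_sum _ _ (tv_bilin.2 _)); apply/rpredZ/rpred_sum => j _.
by apply/rpredZ/memv_span/allpairsP; exists ((vbasis A)`_i, (vbasis B)`_j);
   split=> //=; apply: mem_nth; rewrite size_tuple.
Qed.

Lemma tvs_sub (A : {vspace V}) (B : {vspace W}) (Z : {vspace tens V W}) :
  (forall v w, v \in A -> w \in B -> tv v w \in Z) -> (tvs A B <= Z)%VS.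
Proof.
move=> AB; apply/span_subvP=> _ /allpairsP[[v w] /= [vA wB ->]].
by apply: AB; exact: vbasis_mem.
Qed.

End Theory.

Lemma bilin_comp (V V' W W' U : vectType k) (b : V' -> W' -> U)
    (f : 'Hom(V, V')) (g : 'Hom(W, W')) :
  bilin b -> bilin (fun v w => b (f v) (g w)).
Proof.
by move=> [bl br]; split=> [w a v v' | v a w w']; rewrite linearP ?bl ?br.
Qed.

Lemma bilin_sum (I : finType) (V W U : vectType k) (b : I -> V -> W -> U) :
  (forall i, bilin (b i)) -> bilin (fun v w => \sum_i b i v w).
Proof.
move=> bb; split=> [w a v v' | v a w w']; rewrite scaler_sumr -big_split;
  apply: eq_bigr => i _ /=; [exact: (bb i).1 | exact: (bb i).2].
Qed.

Lemma tmapE (V V' W W' : vectType k) (f : 'Hom(V, V')) (g : 'Hom(W, W')) v w :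
  tmap f g (tv v w) = tv (f v) (g w).
Proof. by rewrite tliftE //; apply: (bilin_comp _ _ (tv_bilin _ _)). Qed.

Lemma lin_hom (U1 U2 : vectType k) (F : U1 -> U2) :
  linear F -> exists h : 'Hom(U1, U2), forall u, h u = F u.
Proof.
move=> lin; pose B := GRing.isLinear.Build _ _ _ _ _ lin.
pose g : {linear U1 -> U2} := HB.pack F B.
by exists (linfun g) => u; rewrite lfunE.
Qed.

(* [inv_lfun] is only a partial inverse in general; see [assoc_inv] and
   [braid_inv] for the associator and the braiding. *)
Lemma inv_lfun_eq (U1 U2 : vectType k) (f : 'Hom(U1, U2)) (g : 'Hom(U2, U1)) :
  (g \o f)%VF = \1%VF -> (f \o g)%VF = \1%VF -> (f^-1)%VF = g.
Proof.
move=> gf fg; have e := inv_lfun_def f.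
have : (g \o (f \o f^-1 \o f) \o g = g \o f \o g)%VF by rewrite e.
rewrite !comp_lfunA gf !comp_lfun1l -comp_lfunA fg.
by rewrite comp_lfun1r.
Qed.

(* Applied to a definition that unfolds to a sum, [directv] would also assert
   that this inner sum is direct; [direct_family] prevents this. *)
Definition direct_family (I : finType) (U : vectType k)
    (Vs : I -> {vspace U}) : Prop :=
  directv (\sum_i Vs i).

Lemma directv_proj (I : finType) (U : vectType k) (Vs : I -> {vspace U})
    (P : I -> 'End(U)) :
  (forall i j u, u \in Vs j -> P i u = if i == j then u else 0) ->
  direct_family Vs.
Proof.
move=> PE; apply/directv_sum_independent=> us usV us0 i _.
have := congr1 (P i) us0; rewrite linear0 linear_sum (bigD1 i) //=.
rewrite (PE i i) ?usV // eqxx big1 ?addr0 // => j ne.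
by rewrite (PE i j) ?usV // eq_sym (negbTE ne).
Qed.

End Tensor.

Section CosetMaps.
Variables (X : finGroupType) (G : {group X}) (M : {set X}).

(* x = gpart x * mpart x; for a transversal M of the cosets Gs these are the
   factors u \in G and s \in M of x = us. *)
Definition mpart (x : X) : X :=
  odflt 1%g [pick s in M | (x * s^-1)%g \in G].
Definition gpart (x : X) : X := (x * (mpart x)^-1)%g.

Definition ctau (s t : X) : X := gpart (s * t)%g.
Definition cdot (s t : X) : X := mpart (s * t)%g.
Definition clact (s u : X) : X := mpart (s * u)%g.

End CosetMaps.

Record coset_data (X : finGroupType) := CosetData {
  cosG : {group X};
  cosM : {set X};
  cos1 : 1%g \in cosM;
  cos_fact : forall x : X, exists! us : X * X,
    [/\ us.1 \in cosG, us.2 \in cosM & x = (us.1 * us.2)%g];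
  cos_ldiv : forall s p : X, s \in cosM -> p \in cosM ->
    exists! t : X, t \in cosM /\ cdot cosG cosM s t = p
}.

Section Factor.
Variables (X : finGroupType) (C : coset_data X).
Local Notation G := (cosG C).
Local Notation M := (cosM C).

Definition gp (x : X) : X := gpart G M x.
Definition mp (x : X) : X := mpart G M x.

(* The element |a| of the decomposition a = |a|^-1 <a>; <a> is [mp a]. *)
Definition gabs (a : X) : X := (gp a)^-1%g.

Definition tau (s t : X) : X := ctau G M s t.
Definition lact (s u : X) : X := clact G M s u.

(* The action y ~<| x = x^-1 y x is MathComp's conjugation (y ^ x)%g.
   With a = vt, b = wp and a ~<| x = v't', [circ a b] is a o b = wvtp and
   [tract a x] is a ~|> x = v^-1 x v'. *)
Definition circ (a b : X) : X := (gp b * gp a * mp a * mp b)%g.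
Definition tract (a x : X) : X := ((gp a)^-1 * x * gp (a ^ x))%g.

Lemma gp_mp x : (gp x * mp x)%g = x.
Proof. by rewrite /gp /gpart mulgKV. Qed.

Lemma mp_gp x : mp x \in M /\ gp x \in G.
Proof.
rewrite /gp /mp /gpart /mpart; case: pickP => [s /andP[] //|none].
have [[u s] [[uG sM xus] _]] := cos_fact C x.
by have /= := none s; rewrite sM xus /= mulgK uG.
Qed.

Lemma mpM x : mp x \in M. Proof. exact: (mp_gp x).1. Qed.
Lemma gpG x : gp x \in G. Proof. exact: (mp_gp x).2. Qed.

Lemma fact_uniq u s : u \in G -> s \in M ->
  gp (u * s)%g = u /\ mp (u * s)%g = s.
Proof.
move=> uG sM; have [us [_ U]] := cos_fact C (u * s)%g.
have := U (u, s) (And3 uG sM erefl).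
have H : [/\ gp (u * s)%g \in G, mp (u * s)%g \in M
          & (u * s)%g = (gp (u * s) * mp (u * s))%g].
  by rewrite gp_mp gpG mpM.
by have -> := U (gp (u * s), mp (u * s))%g H; case.
Qed.

Lemma circE a b : circ a b = (gp b * a * mp b)%g.
Proof. by rewrite -{2}(gp_mp a) /circ !mulgA. Qed.

Lemma circ_ex a z : exists b, circ a b = z.
Proof.
have [t [[tM ht] _]] := cos_ldiv (mpM a) (mpM z).
have wG : (z * t^-1 * a^-1)%g \in G.
  have ez : z = (gp z * ((gp (mp a * t))^-1 * (mp a * t)))%g.
    rewrite -[LHS](gp_mp z); congr (_ * _)%g.
    by rewrite -[LHS]ht; apply: (canRL (mulKg _)); exact: gp_mp.
  have ea : (a^-1 = (mp a)^-1 * (gp a)^-1)%g by rewrite -invMg gp_mp.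
  rewrite {1}ez ea !mulgA !mulgK; exact: groupM (groupM (gpG _) (groupVr (gpG _))) (groupVr (gpG _)).
exists (z * t^-1 * a^-1 * t)%g; have [g1 m1] := fact_uniq wG tM.
by rewrite circE g1 m1 !mulgKV.
Qed.

Lemma circ_inj a b b' : circ a b = circ a b' -> b = b'.
Proof.
move=> e.
have dec c : mp (circ a c) = cdot G M (mp a) (mp c).
  have -> : circ a c =
      ((gp c * gp a * gp (mp a * mp c)) * mp (mp a * mp c))%g.
    rewrite -[RHS]mulgA gp_mp; exact: esym (mulgA _ _ _).
  have g3 := groupM (groupM (gpG c) (gpG a)) (gpG (mp a * mp c)%g).
  by case: (fact_uniq g3 (mpM (mp a * mp c)%g)).
have emp : mp b = mp b'.
  have [t [_ U]] := cos_ldiv (mpM a) (mpM (circ a b)).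
  rewrite -(U (mp b)); last by split; [exact: mpM | rewrite -dec].
  by apply: U; split; [exact: mpM | rewrite -dec e].
move: e; rewrite !circE emp => /mulIg /mulIg egp.
by rewrite -(gp_mp b) -(gp_mp b') egp emp.
Qed.

Lemma tractE a x : tract a x = (mp a * x * (mp (a ^ x))^-1)%g.
Proof.
rewrite /tract -[gp (a ^ x)%g]/(a ^ x * (mp (a ^ x))^-1)%g [LHS]mulgA.
congr (_ * _)%g; rewrite conjgE -[LHS]mulgA mulKVg.
by apply: (canLR (mulKg _)); rewrite [RHS]mulgA gp_mp.
Qed.

Lemma tract1 a : tract a 1%g = 1%g.
Proof. by rewrite /tract conjg1 mulg1 mulVg. Qed.

Lemma tractM a x y : tract a (x * y)%g = (tract a x * tract (a ^ x) y)%g.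
Proof. by rewrite !tractE conjgM !mulgA mulgKV. Qed.

Lemma circ_conj a b x : circ (a ^ tract b x)%g (b ^ x)%g = (circ a b ^ x)%g.
Proof.
rewrite circE -[gp _]/(b ^ x * (mp (b ^ x))^-1)%g.
rewrite [(a ^ _)%g]conjgE tractE circE.
have eb : (b = gp b * mp b)%g by rewrite gp_mp.
move: (gp b) (mp b) (mp (b ^ x)%g) eb => g m m' ->.
by rewrite !conjgE !invMg invgK !mulgA !(mulgKV, mulgK).
Qed.

End Factor.

Record dobj (k : fieldType) (X : finGroupType) := DObj {
  car :> vectType k;
  gr : X -> {vspace car};
  dact : X -> 'End(car);
  gr_direct : direct_family gr;
  gr_full : (\sum_x gr x)%VS = fullv;
  act1 : forall v, dact 1%g v = v;
  actM : forall x y v, dact (x * y)%g v = dact y (dact x v);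
  act_gr : forall x y v, v \in gr y -> dact x v \in gr (y ^ x)%g
}.
Arguments dact {k X} d x.

Section Objects.
Variables (k : fieldType) (X : finGroupType).

Definition is_mor (V W : dobj k X) (f : 'Hom(V, W)) : Prop :=
  (forall x v, v \in gr V x -> f v \in gr W x) /\
  (forall x v, f (dact V x v) = dact W x (f v)).

Definition hcomp (V : dobj k X) (x : X) : 'End(V) :=
  sumv_pi (\sum_x gr V x)%VS x.

(* The linear map on V (x) W given by v (x) w |-> b x y v w for v homogeneous
   of grade x and w homogeneous of grade y; see [gliftE]. *)
Definition glift (V W : dobj k X) (U : vectType k) (b : X -> X -> V -> W -> U) :
    'Hom(tens V W, U) :=
  tlift (fun v w => \sum_x \sum_y b x y (hcomp V x v) (hcomp W y w)).

Section Theory.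

Lemma comp_gr (V : dobj k X) x (v : V) : hcomp V x v \in gr V x.
Proof. exact: memv_sum_pi. Qed.

Lemma comp_sum (V : dobj k X) (v : V) : \sum_x hcomp V x v = v.
Proof. by rewrite sumv_pi_sum // gr_full memvf. Qed.

Lemma compE (V : dobj k X) x y (v : V) :
  v \in gr V y -> hcomp V x v = if x == y then v else 0.
Proof.
move=> vy; have/directv_sum_unique D := gr_direct V.
have := D (fun z => hcomp V z v) (fun z => if z == y then v else 0).
rewrite comp_sum -big_mkcond big_pred1_eq eqxx => E.
have/esym/forall_inP : true = [forall (i | true),
    hcomp V i v == (if i == y then v else 0)].
  apply: E => i _; first exact: comp_gr.
  by case: eqP => [->|_] //; rewrite mem0v.
by move=> /(_ x isT)/eqP.
Qed.

Variables V W : dobj k X.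

Lemma gliftE (U : vectType k) (b : X -> X -> V -> W -> U) x y v w :
  (forall x y, bilin (b x y)) -> v \in gr V x -> w \in gr W y ->
  glift b (tv v w) = b x y v w.
Proof.
move=> bb vx wy; have b0l x' y' w' : b x' y' 0 w' = 0.
  have := (bb x' y').1 w' (-1) 0 0.
  by rewrite scaler0 addr0 scaleN1r addNr.
have b0r x' y' v' : b x' y' v' 0 = 0.
  have := (bb x' y').2 v' (-1) 0 0.
  by rewrite scaler0 addr0 scaleN1r addNr.
rewrite tliftE; last first.
  do 2!apply: bilin_sum => ?; exact: bilin_comp.
rewrite (bigD1 x) //= [X in _ + X]big1 => [|x' ne]; last first.
  by rewrite big1 // => y' _; rewrite (compE x' vx) (negbTE ne) b0l.
rewrite addr0 (bigD1 y) //= big1 => [|y' ne]; last first.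
  by rewrite (compE y' wy) (negbTE ne) b0r.
by rewrite addr0 (compE x vx) (compE y wy) !eqxx.
Qed.

Lemma glift_ext (U : vectType k) (f g : 'Hom(tens V W, U)) :
  (forall x y v w, v \in gr V x -> w \in gr W y -> f (tv v w) = g (tv v w)) ->
  f = g.
Proof.
move=> fg; apply: tens_ext => v w.
rewrite -(comp_sum v) -(comp_sum w).
have sumZ (A : dobj k X) (F : X -> A) : \sum_x F x = \sum_x 1 *: F x.
  by apply: eq_bigr => i _; rewrite scale1r.
rewrite (sumZ V) (lin_sum _ _ ((tv_bilin V W).1 _)) !linear_sum.
apply: eq_bigr => x _; rewrite !linearZ /=; congr (_ *: _).
rewrite (sumZ W) (lin_sum _ _ ((tv_bilin V W).2 _)) !linear_sum.
apply: eq_bigr => y _; rewrite !linearZ /=; congr (_ *: _).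
exact: fg (comp_gr _ _) (comp_gr _ _).
Qed.

Lemma glift_ext3l (V3 : dobj k X) (U : vectType k)
    (f g : 'Hom(tens (tens V W) V3, U)) :
  (forall x y z v w u, v \in gr V x -> w \in gr W y -> u \in gr V3 z ->
     f (tv (tv v w) u) = g (tv (tv v w) u)) -> f = g.
Proof.
move=> fg; apply: tens_ext => A u.
have [h hE] := lin_hom ((tv_bilin (tens V W) V3).1 u).
rewrite -hE -!comp_lfunE; congr (fun_of_lfun _ _).
apply: glift_ext => x y v w vx wy; rewrite !comp_lfunE hE.
have [h' hE'] := lin_hom ((tv_bilin (tens V W) V3).2 (tv v w)).
rewrite -hE' -(comp_sum u) !linear_sum; apply: eq_bigr => z _.
by rewrite /= !hE'; apply: fg vx wy (comp_gr _ _).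
Qed.

Lemma glift_ext3r (V3 : dobj k X) (U : vectType k)
    (f g : 'Hom(tens V3 (tens V W), U)) :
  (forall x y z v w u, v \in gr V x -> w \in gr W y -> u \in gr V3 z ->
     f (tv u (tv v w)) = g (tv u (tv v w))) -> f = g.
Proof.
move=> fg; apply: tens_ext => u A.
have [h hE] := lin_hom ((tv_bilin V3 (tens V W)).2 u).
rewrite -hE -!comp_lfunE; congr (fun_of_lfun _ _).
apply: glift_ext => x y v w vx wy; rewrite !comp_lfunE hE.
have [h' hE'] := lin_hom ((tv_bilin V3 (tens V W)).1 (tv v w)).
rewrite -hE' -(comp_sum u) !linear_sum; apply: eq_bigr => z _.
by rewrite /= !hE'; apply: fg vx wy (comp_gr _ _).
Qed.

End Theory.
End Objects.

Section TensorObject.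
Variables (k : fieldType) (X : finGroupType) (C : coset_data X).
Variables V W : dobj k X.

Definition tgr (x : X) : {vspace tens V W} :=
  (\sum_(p : X * X | circ C p.1 p.2 == x) tvs (gr V p.1) (gr W p.2))%VS.

Definition tact (x : X) : 'End(tens V W) :=
  glift (fun a b (v : V) (w : W) => tv (dact V (tract C b x) v) (dact W x w)).

Lemma mem_tgr a b v w : v \in gr V a -> w \in gr W b ->
  tv v w \in tgr (circ C a b).
Proof.
move=> va wb; have /subvP : (tvs (gr V a) (gr W b) <= tgr (circ C a b))%VS.
  exact: (sumv_sup (a, b)).
by apply; apply: mem_tvs.
Qed.

Lemma tgr_sub x (Z : {vspace tens V W}) :
  (forall a b v w, circ C a b = x -> v \in gr V a -> w \in gr W b ->
     tv v w \in Z) -> (tgr x <= Z)%VS.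
Proof.
move=> h; apply/subv_sumP=> -[a b] /= /eqP ab.
by apply: tvs_sub => v w; apply: h.
Qed.

Lemma tactE x a b v w : v \in gr V a -> w \in gr W b ->
  tact x (tv v w) = tv (dact V (tract C b x) v) (dact W x w).
Proof.
move=> va wb; rewrite (gliftE _ va wb) // => a' b'.
exact: bilin_comp (tv_bilin _ _).
Qed.

Lemma tgr_full : (\sum_x tgr x)%VS = fullv.
Proof.
apply/eqP; rewrite eqEsubv subvf; apply/subvP=> A _.
rewrite (tens_span A); apply: rpred_sum => i _; apply: rpred_sum => j _.
apply: rpredZ; set v := (vbasis {:V})`_i; set w := (vbasis {:W})`_j.
rewrite -(comp_sum v) -(comp_sum w).
have sumZ (B : dobj k X) (F : X -> B) : \sum_x F x = \sum_x 1 *: F x.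
  by apply: eq_bigr => ? _; rewrite scale1r.
rewrite (sumZ V) (lin_sum _ _ ((tv_bilin V W).1 _)).
apply: rpred_sum => x _; apply: rpredZ.
rewrite (sumZ W) (lin_sum _ _ ((tv_bilin V W).2 _)).
apply: rpred_sum => y _; apply: rpredZ.
have /subvP : (tgr (circ C x y) <= \sum_x tgr x)%VS by exact: (sumv_sup (circ C x y)).
by apply; apply: mem_tgr; exact: comp_gr.
Qed.

Lemma tgr_direct : direct_family tgr.
Proof.
pose P x : 'End(tens V W) := glift (fun a b (v : V) (w : W) =>
  (circ C a b == x)%:R *: tv v w).
have PE x a b v w : v \in gr V a -> w \in gr W b ->
    P x (tv v w) = (circ C a b == x)%:R *: tv v w.
  move=> va wb; rewrite (gliftE _ va wb) // => a' b'.
  case: (tv_bilin V W) => l r.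
  by split=> [w1 c v1 v2 | v1 c w1 w2]; rewrite ?l ?r scalerDr !scalerA mulrC.
apply: (@directv_proj _ _ _ _ P) => x y u uy.
pose Z := lker (P x - (y == x)%:R *: \1)%VF.
have /subvP/(_ u uy) : (tgr y <= Z)%VS.
  apply: tgr_sub => a b v w ab va wb; rewrite memv_ker.
  by rewrite add_lfunE opp_lfunE scale_lfunE id_lfunE (PE _ _ _ _ _ va wb) ab subrr.
rewrite memv_ker add_lfunE opp_lfunE scale_lfunE id_lfunE subr_eq0 => /eqP ->.
by rewrite eq_sym; case: eqP; rewrite ?scale1r ?scale0r.
Qed.

Lemma tact_gr x y u : u \in tgr y -> tact x u \in tgr (y ^ x)%g.
Proof.
pose Z := (tact x @^-1: tgr (y ^ x)%g)%VS.
have /subvP h : (tgr y <= Z)%VS.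
  apply: tgr_sub => a b v w ab va wb.
  rewrite -memv_preim (tactE _ va wb) -ab -circ_conj.
  by apply: mem_tgr; apply: act_gr.
by move=> /h; rewrite -memv_preim.
Qed.

Lemma tact1 u : tact 1%g u = u.
Proof.
rewrite -[RHS]id_lfunE; congr (fun_of_lfun _ _); apply: glift_ext.
move=> a b v w va wb.
by rewrite (tactE _ va wb) id_lfunE tract1 !act1.
Qed.

Lemma tactM x y u : tact (x * y)%g u = tact y (tact x u).
Proof.
rewrite -comp_lfunE; congr (fun_of_lfun _ _); apply: glift_ext.
move=> a b v w va wb; rewrite comp_lfunE !(tactE _ va wb).
by rewrite (tactE _ (act_gr _ va) (act_gr _ wb)) tractM !actM.
Qed.

Definition tobj : dobj k X :=
  DObj tgr_direct tgr_full tact1 tactM tact_gr.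

End TensorObject.

Section Category.
Variables (k : fieldType) (X : finGroupType) (C : coset_data X).
Local Notation "V *o W" := (tobj C V W) (at level 40, left associativity).

Definition assoc (U V W : dobj k X) : 'Hom(U *o V *o W, U *o (V *o W)) :=
  @glift k X (U *o V) W _ (fun _ c uv w =>
    @glift k X U V _ (fun _ b u v =>
      tv (dact U (tau C (mp C b) (mp C c)) u) (tv v w)) uv).

Definition braid (V W : dobj k X) : 'Hom(V *o W, W *o V) :=
  @glift k X V W _ (fun a b v w =>
    tv (dact W (lact C (mp C a) (gabs C b))^-1%g w) (dact V (gabs C b) v)).

Lemma braidE (V W : dobj k X) a b v w : v \in gr V a -> w \in gr W b ->
  braid V W (tv v w) =
  tv (dact W (lact C (mp C a) (gabs C b))^-1%g w) (dact V (gabs C b) v).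
Proof.
move=> va wb; rewrite /braid (gliftE _ va wb) // => a' b'.
by case: (tv_bilin W V) => l r; split=> [w1 c v1 v2 | v1 c w1 w2];
   rewrite linearP ?l ?r.
Qed.

Lemma assocE (U V W : dobj k X) a b c u v w :
  u \in gr U a -> v \in gr V b -> w \in gr W c ->
  assoc U V W (tv (tv u v) w) =
  tv (dact U (tau C (mp C b) (mp C c)) u) (tv v w).
Proof.
move=> ua vb wc.
have bil c' w' (x y : X) : bilin (fun (u : U) (v : V) =>
    tv (dact U (tau C (mp C y) (mp C c')) u) (tv v w' : V *o W)).
  case: (tv_bilin U (V *o W)) => l r; case: (tv_bilin V W) => l' r'.
  by split=> [w1 e v1 v2 | v1 e w1 w2]; rewrite ?linearP ?l' ?l ?r.
pose g c' w' : 'Hom(tens U V, U *o (V *o W)) :=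
  @glift k X U V _ (fun _ b' u' v' =>
    tv (dact U (tau C (mp C b') (mp C c')) u') (tv v' w' : V *o W)).
have glin c' : linear (g c').
  move=> e w1 w2; apply: glift_ext => a' b' u' v' ua' vb'.
  rewrite add_lfunE scale_lfunE /g !(gliftE (bil _ _) ua' vb').
  case: (tv_bilin U (V *o W)) => l r; case: (tv_bilin V W) => l' r'.
  by rewrite r' r.
have gbil (x y : X) : bilin (fun (uv : U *o V) (w' : W) => g y w' uv).
  split=> [w1 | v1] e p q; first exact: linearP.
  by rewrite glin add_lfunE scale_lfunE.
have uvab : (tv u v : U *o V) \in gr (U *o V) (circ C a b) by exact: mem_tgr.
by apply: etrans (gliftE gbil uvab wc) _; rewrite /g (gliftE (bil _ _) ua vb).
Qed.

Definition assoc_rev (U V W : dobj k X) :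
    'Hom(U *o (V *o W), U *o V *o W) :=
  @glift k X U (V *o W) _ (fun _ _ u vw =>
    @glift k X V W _ (fun b c v w =>
      tv (tv (dact U (tau C (mp C b) (mp C c))^-1%g u) v) w) vw).

Lemma assoc_revE (U V W : dobj k X) a b c u v w :
  u \in gr U a -> v \in gr V b -> w \in gr W c ->
  assoc_rev U V W (tv u (tv v w)) =
  tv (tv (dact U (tau C (mp C b) (mp C c))^-1%g u) v) w.
Proof.
move=> ua vb wc.
have bil u' (x y : X) : bilin (fun (v : V) (w : W) =>
    tv (tv (dact U (tau C (mp C x) (mp C y))^-1%g u') v : U *o V) w).
  case: (tv_bilin U V) => l r; case: (tv_bilin (U *o V) W) => l' r'.
  by split=> [w1 e v1 v2 | v1 e w1 w2]; rewrite ?r ?l' ?r'.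
pose g u' : 'Hom(tens V W, U *o V *o W) :=
  @glift k X V W _ (fun b' c' v' w' =>
    tv (tv (dact U (tau C (mp C b') (mp C c'))^-1%g u') v' : U *o V) w').
have glin : linear g.
  move=> e u1 u2; apply: glift_ext => b' c' v' w' vb' wc'.
  rewrite add_lfunE scale_lfunE /g !(gliftE (bil _) vb' wc').
  case: (tv_bilin U V) => l r; case: (tv_bilin (U *o V) W) => l' r'.
  by rewrite linearP l l'.
have gbil (x y : X) : bilin (fun (u' : U) (vw : V *o W) => g u' vw).
  split=> [w1 | v1] e p q; last exact: linearP.
  by rewrite glin add_lfunE scale_lfunE.
have vwbc : (tv v w : V *o W) \in gr (V *o W) (circ C b c) by exact: mem_tgr.
by apply: etrans (gliftE gbil ua vwbc) _; rewrite /g (gliftE (bil _) vb wc).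
Qed.

Lemma assoc_inv (U V W : dobj k X) : (assoc U V W)^-1%VF = assoc_rev U V W.
Proof.
apply: inv_lfun_eq.
  apply: (@glift_ext3l k X U V W) => a b c u v w ua vb wc.
  have ua' := act_gr (tau C (mp C b) (mp C c)) ua.
  rewrite comp_lfunE id_lfunE (assocE ua vb wc) (assoc_revE ua' vb wc).
  by rewrite -actM mulgV act1.
apply: (@glift_ext3r k X V W U) => b c a v w u vb wc ua.
have ua' := act_gr (tau C (mp C b) (mp C c))^-1%g ua.
rewrite comp_lfunE id_lfunE (assoc_revE ua vb wc) (assocE ua' vb wc).
by rewrite -actM mulVg act1.
Qed.

Definition braid_rev (V W : dobj k X) : 'Hom(W *o V, V *o W) :=
  @glift k X W V _ (fun c d w v =>
    tv (dact V (gabs C (c ^ mp C d)%g)^-1%g v) (dact W (mp C d) w)).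

Lemma braid_revE (V W : dobj k X) c d w v : w \in gr W c -> v \in gr V d ->
  braid_rev V W (tv w v) =
  tv (dact V (gabs C (c ^ mp C d)%g)^-1%g v) (dact W (mp C d) w).
Proof.
move=> wc vd; rewrite /braid_rev (gliftE _ wc vd) // => c' d'.
by case: (tv_bilin V W) => l r; split=> [w1 e v1 v2 | v1 e w1 w2];
   rewrite linearP ?l ?r.
Qed.

Lemma braid_inv (V W : dobj k X) : (braid V W)^-1%VF = braid_rev V W.
Proof.
have lactE a b : lact C (mp C a) (gabs C b) = mp C (a ^ gabs C b)%g.
  have -> : (a ^ gabs C b = (gp C b * gp C a * gp C (mp C a * gabs C b)) *
                            mp C (mp C a * gabs C b))%g.
    rewrite -[RHS]mulgA gp_mp conjgE /gabs invgK -{1}(gp_mp C a).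
    by rewrite !mulgA.
  have g3 := groupM (groupM (gpG C b) (gpG C a)) (gpG C (mp C a * gabs C b)%g).
  by have [_ ->] := fact_uniq g3 (mpM C (mp C a * gabs C b)%g).
apply: inv_lfun_eq; apply: glift_ext.
  move=> a b v w va wb; rewrite comp_lfunE id_lfunE (braidE va wb).
  rewrite (braid_revE (act_gr _ wb) (act_gr _ va)) lactE -!actM -conjgM.
  by rewrite mulVg conjg1 mulgV !act1.
move=> c d w v wc vd; rewrite comp_lfunE id_lfunE (braid_revE wc vd).
rewrite (braidE (act_gr _ vd) (act_gr _ wc)) lactE -!actM -conjgM.
by rewrite mulVg conjg1 mulgV !act1.
Qed.

End Category.

Section DObject.
Variables (k : fieldType) (X : finGroupType) (C : coset_data X).

(* [Del y x] is the basis vector delta_y (x) x. *)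
Definition Dcar : vectType k := {ffun X * X -> k^o}.
Definition Del (y x : X) : Dcar := [ffun p => (p == (y, x))%:R].

Definition dlift (U : vectType k) (f : X -> X -> U) : 'Hom(Dcar, U) :=
  linfun (fun d : Dcar => \sum_p (d p : k) *: f p.1 p.2).

(* The grade of delta_y (x) x; see [DgradeP]. *)
Definition Dgrade (y x : X) : X :=
  odflt 1%g [pick a | circ C y a == (y ^ x)%g].

Lemma DgradeP y x a : Dgrade y x = a <-> circ C y a = (y ^ x)%g.
Proof.
have e : circ C y (Dgrade y x) = (y ^ x)%g.
  rewrite /Dgrade; case: pickP => [b /eqP //|none].
  by have [b /eqP] := circ_ex C y (y ^ x)%g; rewrite none.
by split=> [<- // | ]; rewrite -e => /circ_inj ->.
Qed.

Lemma Dgrade_circ y x : circ C y (Dgrade y x) = (y ^ x)%g.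
Proof. exact/DgradeP. Qed.

Definition Dgr (a : X) : {vspace Dcar} :=
  <<[seq Del p.1 p.2 | p <- enum [pred p : X * X | Dgrade p.1 p.2 == a]]>>%VS.

Definition Dact (z : X) : 'End(Dcar) :=
  dlift (fun y x => let t := tract C (Dgrade y x) z in
                    Del (y ^ t)%g (t^-1 * x * z)%g).

Lemma dlift_def (U : vectType k) (f : X -> X -> U) (d : Dcar) :
  dlift f d = \sum_p (d p : k) *: f p.1 p.2.
Proof.
have lin : linear (fun d : Dcar => \sum_p (d p : k) *: f p.1 p.2).
  move=> a d1 d2; rewrite scaler_sumr -big_split; apply: eq_bigr => p _ /=.
  by rewrite !ffunE scalerDl scalerA.
pose F := GRing.isLinear.Build _ _ _ _ _ lin.
pose g : {linear Dcar -> U} := HB.pack (fun d : Dcar =>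
  \sum_p (d p : k) *: f p.1 p.2) F.
exact: (lfunE g).
Qed.

Lemma dliftE (U : vectType k) (f : X -> X -> U) y x :
  dlift f (Del y x) = f y x.
Proof.
rewrite dlift_def (bigD1 (y, x)) //= ffunE eqxx scale1r big1 ?addr0 // => p ne.
by rewrite ffunE (negbTE ne) scale0r.
Qed.

Lemma D_span (d : Dcar) : d = \sum_p (d p : k) *: Del p.1 p.2.
Proof.
apply/ffunP=> q; rewrite sum_ffunE (bigD1 q) //= big1 => [|p ne].
  by rewrite !ffunE -surjective_pairing eqxx addr0 [RHS]mulr1.
by rewrite !ffunE -surjective_pairing eq_sym (negbTE ne) [LHS]mulr0.
Qed.

Lemma D_ext (U : vectType k) (f g : 'Hom(Dcar, U)) :
  (forall y x, f (Del y x) = g (Del y x)) -> f = g.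
Proof.
move=> fg; apply/lfunP=> d; rewrite (D_span d) !linear_sum.
by apply: eq_bigr => p _; rewrite !linearZ /= fg.
Qed.

Lemma Dact_el y x z (t := tract C (Dgrade y x) z) :
  Dact z (Del y x) = Del (y ^ t)%g (t^-1 * x * z)%g.
Proof. exact: dliftE. Qed.

Lemma mem_Dgr y x : Del y x \in Dgr (Dgrade y x).
Proof.
by apply/memv_span/mapP; exists (y, x) => //; rewrite mem_enum inE.
Qed.

Lemma Dgr_sub a (Z : {vspace Dcar}) :
  (forall y x, Dgrade y x = a -> Del y x \in Z) -> (Dgr a <= Z)%VS.
Proof.
move=> h; apply/span_subvP=> u /mapP[[y x] yx ->]; apply: h.
by move: yx; rewrite mem_enum inE => /eqP.
Qed.

Lemma Dgr_full : (\sum_a Dgr a)%VS = fullv.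
Proof.
apply/eqP; rewrite eqEsubv subvf; apply/subvP=> d _.
rewrite (D_span d); apply: rpred_sum => p _; apply: rpredZ.
have /subvP : (Dgr (Dgrade p.1 p.2) <= \sum_a Dgr a)%VS.
  exact: (sumv_sup (Dgrade p.1 p.2)).
by apply; apply: mem_Dgr.
Qed.

Lemma Dgr_direct : direct_family Dgr.
Proof.
pose P a : 'End(Dcar) := dlift (fun y x => (Dgrade y x == a)%:R *: Del y x).
apply: (@directv_proj _ _ _ _ P) => a b u ub.
have /subvP/(_ u ub) : (Dgr b <= lker (P a - (b == a)%:R *: \1)%VF)%VS.
  apply: Dgr_sub => y x yx; rewrite memv_ker.
  by rewrite add_lfunE opp_lfunE scale_lfunE id_lfunE dliftE yx subrr.
rewrite memv_ker add_lfunE opp_lfunE scale_lfunE id_lfunE subr_eq0 => /eqP ->.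
by rewrite eq_sym; case: eqP; rewrite ?scale1r ?scale0r.
Qed.

Lemma Dgrade_act y x z (t := tract C (Dgrade y x) z) :
  Dgrade (y ^ t)%g (t^-1 * x * z)%g = (Dgrade y x ^ z)%g.
Proof.
apply/DgradeP; rewrite circ_conj Dgrade_circ -!conjgM; congr (_ ^ _)%g.
by rewrite !mulgA mulgV mul1g.
Qed.

Lemma Dact_gr z a u : u \in Dgr a -> Dact z u \in Dgr (a ^ z)%g.
Proof.
have /subvP h : (Dgr a <= Dact z @^-1: Dgr (a ^ z)%g)%VS.
  apply: Dgr_sub => y x <-; rewrite -memv_preim Dact_el -Dgrade_act.
  exact: mem_Dgr.
by move=> /h; rewrite -memv_preim.
Qed.

Lemma Dact1 u : Dact 1%g u = u.
Proof.
rewrite -[RHS]id_lfunE; congr (fun_of_lfun _ _); apply: D_ext => y x.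
by rewrite Dact_el id_lfunE tract1 conjg1 invg1 mul1g mulg1.
Qed.

Lemma DactM z1 z2 u : Dact (z1 * z2)%g u = Dact z2 (Dact z1 u).
Proof.
rewrite -comp_lfunE; congr (fun_of_lfun _ _); apply: D_ext => y x.
rewrite comp_lfunE !Dact_el Dgrade_act tractM conjgM.
by rewrite invMg !mulgA.
Qed.

Definition Dobj : dobj k X :=
  DObj Dgr_direct Dgr_full Dact1 DactM Dact_gr.

Local Notation D := Dobj.
Local Notation "V *o W" := (tobj C V W) (at level 40, left associativity).

Definition alpha (V : dobj k X) : 'Hom(V *o D, V) :=
  tlift (fun v d => dlift (fun y x => dact V x (hcomp V y v)) d).

Lemma alphaE (V : dobj k X) a v y x : v \in gr V a ->
  alpha V (tv v (Del y x)) = (y == a)%:R *: dact V x v.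
Proof.
move=> va; rewrite /alpha tliftE.
  rewrite dliftE (compE _ va).
  by case: (y == a); rewrite ?scale1r // linear0 scale0r.
split=> [d c v1 v2 | v1 c d1 d2]; last by rewrite linearP.
rewrite !dlift_def scaler_sumr -big_split; apply: eq_bigr => p _ /=.
rewrite [hcomp V p.1 _]linearP [dact V p.2 _]linearP /=.
by rewrite scalerDr !scalerA mulrC.
Qed.

Definition act_with (Dp : 'Hom(D, D *o D)) (V W : dobj k X) :
    'Hom(V *o W *o D, V *o W) :=
  (tmap (alpha V) (alpha W)
   \o (assoc C V D (W *o D))^-1
   \o tmap \1 (assoc C D W D)
   \o tmap \1 (tmap (braid C W D) \1)
   \o tmap \1 (assoc C W D D)^-1
   \o assoc C V W (D *o D)
   \o tmap \1 Dp)%VF.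

Definition is_coproduct (Delta : 'Hom(D, D *o D)) : Prop :=
  is_mor Delta /\
  forall V W : dobj k X, act_with Delta V W = alpha (V *o W).

(* The action of D on W (x) V on the right is the one formed with Delta. *)
Definition is_opposite_coproduct (Delta Dop : 'Hom(D, D *o D)) : Prop :=
  is_mor Dop /\
  forall V W : dobj k X,
    act_with Dop V W =
    ((braid C V W)^-1 \o act_with Delta W V \o tmap (braid C V W) \1)%VF.

End DObject.

(* Main.v *)
Require Import Defs.
From mathcomp Require Import all_boot all_order all_algebra all_fingroup.

(** The two directions rest on two facts about actions formed with a map
    [D -> D (x) D].

    The first is that the braiding is a natural isomorphism in the category.
    Since [alpha] is natural for morphisms ([alpha_natural]) and the braiding
    [Psi : V (x) W -> W (x) V] is one ([braid_mor]), conjugating the action of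
    [D] on [W (x) V] by [Psi] gives back the action on [V (x) W]
    ([opposite_action]).  Both actions are the ones formed with [Delta], so
    [Delta] satisfies the property that characterizes its opposite.

    The second is that a map [D -> D (x) D] is determined by the actions that
    it forms, so that the characterization has at most one solution
    ([act_with_inj]).  A single object suffices to test this: the regular one,
    [R], with basis the pairs [(p, g)] of grade [p] on which [x] acts by
    [(p ^ x, g x)].  Let [u] be the sum of the vectors [(p, 1)].  Acting on
    [u (x) u] turns an element of [D (x) D] into one of [R (x) R], and a basis
    vector of [D (x) D] becomes a single basis vector of [R (x) R], because the
    delta functions select one grade in each factor ([act_core_unit]).  It
    remains to see that the four group elements indexing a basis vector
    [(delta_y (x) x) (x) (delta_z (x) t)] can be recovered from those indexing
    its image ([outQuad_inj]).  The associators and the braiding conjugate and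
    translate these elements by factors depending on the grades [a] and [b] of
    the two tensorands, so the point is to recover [a] and [b].  The whole
    composite preserves grades, and left division for [o] then yields [a o b];
    writing [q] for the selected grade of the second factor of [u (x) u], the
    final grade [q1] of that factor equals [(q ^ (gp (a o b))^-1) * b], which
    yields [b]; finally [a o b = gp b * a * mp b] yields [a]. *)

Set Implicit Arguments.
Unset Strict Implicit.
Unset Printing Implicit Defensive.

Import GRing.Theory.
Local Open Scope ring_scope.

(** * Grades of tensor products *)

Section CosetIdentities.
Variables (X : finGroupType) (C : coset_data X).
Implicit Types a b p q x y z t : X.

Lemma tau_factor s t : (mp C s * mp C t =
  tau C (mp C s) (mp C t) * mp C (mp C s * mp C t))%g.
Proof. exact: esym (gp_mp C (mp C s * mp C t)%g). Qed.

Lemma tauG s t : tau C s t \in cosG C.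
Proof. exact: gpG. Qed.

Lemma circ_factors a b :
  gp C (circ C a b) = (gp C b * gp C a * tau C (mp C a) (mp C b))%g /\
  mp C (circ C a b) = mp C (mp C a * mp C b)%g.
Proof.
have -> : circ C a b =
    (gp C b * gp C a * tau C (mp C a) (mp C b) * mp C (mp C a * mp C b))%g.
  by rewrite -[RHS]mulgA -tau_factor /circ !mulgA.
have G3 := groupM (groupM (gpG C b) (gpG C a)) (tauG (mp C a) (mp C b)).
exact: fact_uniq G3 (mpM _ _).
Qed.

(** This is the statement that the associator preserves grades: the conjugation
    of [p] by [tau] is the action that the associator performs on the first
    factor. *)
Lemma circA p q x :
  circ C (circ C p q) x = circ C (p ^ tau C (mp C q) (mp C x))%g (circ C q x).
Proof.
have [g m] := circ_factors q x.
rewrite circE [in RHS]circE circE g m conjgE.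
have := tau_factor q x.
move: (mp C (mp C q * mp C x)%g) (tau C _ _) (gp C x) (gp C q) => r s v w.
by rewrite -!mulgA => ->; rewrite !mulgA mulgK.
Qed.

Lemma circ_conj_gabs a b : ((a ^ gabs C b) * b)%g = circ C a b.
Proof.
rewrite circE conjgE /gabs invgK -{3}(gp_mp C b).
by move: (gp C b) => u; rewrite !mulgA mulgKV.
Qed.

(** The group element by which the braiding acts on its second argument thus
    depends only on the grade that its first argument has after braiding; this
    gives the inverse of the braiding and its equivariance. *)
Lemma lact_gabs a b : lact C (mp C a) (gabs C b) = mp C (a ^ gabs C b)%g.
Proof.
have -> : (a ^ gabs C b = (gp C b * gp C a * gp C (mp C a * gabs C b)) *
                          mp C (mp C a * gabs C b))%g.
  rewrite -[RHS]mulgA gp_mp conjgE /gabs invgK -{1}(gp_mp C a).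
  by rewrite !mulgA.
have g3 := groupM (groupM (gpG C b) (gpG C a)) (gpG C (mp C a * gabs C b)%g).
by have [_ ->] := fact_uniq g3 (mpM C (mp C a * gabs C b)%g).
Qed.

(** This is the statement that the braiding preserves grades. *)
Lemma circ_braid a b (a' := (a ^ gabs C b)%g) :
  circ C (b ^ (mp C a')^-1)%g a' = circ C a b.
Proof.
rewrite -[RHS]circ_conj_gabs circE conjgE invgK -/a'.
rewrite -[X in (X * b)%g](gp_mp C a').
by move: (gp C a') (mp C a') => u s; rewrite !mulgA mulgKV.
Qed.

Lemma conjgK_mul x y z : ((x ^ z) ^ (y * z)^-1 = x ^ y^-1)%g.
Proof. by rewrite invMg conjgM conjgK. Qed.

(** * Recovering a basis vector from its action *)

Section Exponents.
Variables y x z t a b : X.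

(** For [delta_y (x) x] of grade [a] and [delta_z (x) t] of grade [b], these are
    the elements of [X] acting on [w], on [delta_y (x) x], and on [v] of [v (x) w]
    on the way from [(V (x) W) (x) (D (x) D)] to [(V (x) D) (x) (W (x) D)]; here
    [q] is the grade of [w].  In [innerExp] and [leftExp] the grade of [w] after
    the action of [rightExp] is taken to be [z]: for any other grade the action
    of [delta_z (x) t] on [w] vanishes. *)
Definition rightExp := ((tau C (mp C a) (mp C b))^-1 * gabs C a)%g.
Definition innerExp := ((mp C z)^-1 * tau C (mp C z) (mp C b))%g.
Definition leftExp q := (tau C (mp C q) (mp C (circ C a b)) *
  (tau C (mp C (a ^ innerExp)) (mp C (circ C z b)))^-1)%g.
(** The indices of the basis vector that [innerExp] makes of [delta_y (x) x]. *)
Definition movedPt := (y ^ tract C a innerExp)%g.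
Definition movedElt := ((tract C a innerExp)^-1 * x * innerExp)%g.

(** Grade and group element of the two regular basis vectors produced by the
    action on [u (x) u]. As they start from the group element 1, the two final
    group elements are exactly what acted on [v] and on [w], so conjugating the
    final grades by their inverses recovers the initial grades. *)
Definition outQuad : (X * X) * (X * X) :=
  ((movedPt ^ movedElt, leftExp (z ^ rightExp^-1) * movedElt),
   (z ^ t, rightExp * t))%g.

Hypotheses (ya : circ C y a = (y ^ x)%g) (zb : circ C z b = (z ^ t)%g).

Lemma moved_circ : circ C movedPt (a ^ innerExp)%g = (movedPt ^ movedElt)%g.
Proof.
rewrite circ_conj ya /movedPt /movedElt -!conjgM; congr (_ ^ _)%g.
by move: (tract C a _) => s; rewrite -!mulgA mulKVg.
Qed.

(** Grade preservation for the part of the composite that moves [w] past the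
    first copy of [D]: an associator, the braiding, and an associator. *)
Lemma circ_swap :
  circ C (z ^ rightExp^-1)%g (circ C a b) = circ C (a ^ innerExp)%g (circ C z b).
Proof.
rewrite /innerExp conjgM -circA.
have := circ_braid (z ^ (gabs C a)^-1)%g a; rewrite conjgKV => ->.
rewrite circA /rightExp; congr (circ C _ _).
by move: (gabs C a) (tau C _ _) => u s; rewrite invMg invgK conjgM.
Qed.

(** Grade preservation for the whole composite. By injectivity of [circ] in its
    second argument it determines [circ C a b] from [outQuad]. *)
Lemma total_grade :
  circ C (circ C (outQuad.1.1 ^ outQuad.1.2^-1)
                 (outQuad.2.1 ^ outQuad.2.2^-1))%g (circ C a b) =
  circ C outQuad.1.1 outQuad.2.1.
Proof.
rewrite /= !conjgK_mul circA circ_swap -moved_circ -zb [RHS]circA.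
congr (circ C _ _); rewrite /leftExp.
by move: (tau C _ _) (tau C _ _) => u s; rewrite invMg invgK conjgM conjgKV.
Qed.

(** Once [circ C a b] is known, this reads off [b], because
    [gp C (circ C a b) = gp C b * rightExp^-1] and
    [circ C z b = gp C b * z * mp C b]. *)
Lemma grade_right :
  ((outQuad.2.1 ^ outQuad.2.2^-1) ^ (gp C (circ C a b))^-1 * b)%g = outQuad.2.1.
Proof.
have [gK _] := circ_factors a b.
rewrite /= conjgK_mul -zb gK /rightExp /gabs circE conjgE conjgE.
rewrite -[X in (_ * X = _)%g](gp_mp C b).
move: (gp C a) (gp C b) (tau C _ _) => u v s.
by rewrite !(invMg, invgK) !mulgA !(mulgK, mulgKV).
Qed.

End Exponents.

Lemma outQuad_inj y x z t a b y' x' z' t' a' b' :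
  circ C y a = (y ^ x)%g -> circ C z b = (z ^ t)%g ->
  circ C y' a' = (y' ^ x')%g -> circ C z' b' = (z' ^ t')%g ->
  outQuad y x z t a b = outQuad y' x' z' t' a' b' ->
  (y, x, (z, t)) = (y', x', (z', t')).
Proof.
move=> ya zb ya' zb' oo.
have ek : circ C a b = circ C a' b'.
  have := total_grade ya zb; rewrite oo -[RHS](total_grade ya' zb').
  exact: circ_inj.
have eb : b = b'.
  have := grade_right y x a zb; rewrite oo ek -[RHS](grade_right y' x' a' zb').
  exact: mulgI.
have ea : a = a'.
  by move: ek; rewrite !circE eb => /mulIg /mulgI.
subst a' b'; case: oo => e1 e2 e3 /mulgI et; subst t'.
move: e3 => /conjg_inj ez; subst z'.
move: e2 => /mulgI ex; rewrite ex in e1; move: e1 => /conjg_inj.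
rewrite /movedPt => /conjg_inj ->.
by move: ex => /mulIg /mulgI ->.
Qed.

End CosetIdentities.

(** * Linear maps on tensor products *)

Section TensorLinearity.
Variables (k : fieldType) (V W : vectType k).

Lemma tv_linl (w : W) : exists h : 'Hom(V, tens V W), forall v, h v = tv v w.
Proof. exact: lin_hom ((tv_bilin V W).1 w). Qed.

Lemma tv_linr (v : V) : exists h : 'Hom(W, tens V W), forall w, h w = tv v w.
Proof. exact: lin_hom ((tv_bilin V W).2 v). Qed.

Lemma tvZl c (v : V) (w : W) : tv (c *: v) w = c *: tv v w.
Proof. by have [h hE] := tv_linl w; rewrite -!hE linearZ. Qed.

Lemma tvZr c (v : V) (w : W) : tv v (c *: w) = c *: tv v w.
Proof. by have [h hE] := tv_linr v; rewrite -!hE linearZ. Qed.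

Lemma tv_suml (I : finType) (f : I -> V) (w : W) :
  tv (\sum_i f i) w = \sum_i tv (f i) w.
Proof.
have [h hE] := tv_linl w.
by rewrite -hE linear_sum; apply: eq_bigr => i _; exact: hE.
Qed.

Lemma tv_sumr (I : finType) (v : V) (f : I -> W) :
  tv v (\sum_i f i) = \sum_i tv v (f i).
Proof.
have [h hE] := tv_linr v.
by rewrite -hE linear_sum; apply: eq_bigr => i _; exact: hE.
Qed.

End TensorLinearity.

(** * The braiding is a natural isomorphism *)

Section BraidMorphism.
Variables (k : fieldType) (X : finGroupType) (C : coset_data X).
Local Notation D := (Dobj k C).
Local Notation "V *o W" := (tobj C V W) (at level 40, left associativity).

Lemma braid_revK (V W : dobj k X) :
  (braid_rev C V W \o braid C V W)%VF = \1%VF.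
Proof.
apply: glift_ext => a b v w va wb; rewrite comp_lfunE id_lfunE.
rewrite (braidE C va wb) (braid_revE C (act_gr _ wb) (act_gr _ va)).
rewrite lact_gabs -!Defs.actM -conjgM.
by rewrite mulVg conjg1 mulgV !Defs.act1.
Qed.

Lemma braid_act (V W : dobj k X) x u :
  braid C V W (dact (V *o W) x u) = dact (W *o V) x (braid C V W u).
Proof.
rewrite -[LHS]comp_lfunE -[RHS]comp_lfunE; congr (fun_of_lfun _ _).
apply: glift_ext => a b v w va wb; rewrite !comp_lfunE.
rewrite /= (tactE C x va wb) (braidE C va wb).
rewrite (braidE C (act_gr _ va) (act_gr _ wb)).
rewrite (tactE C x (act_gr _ wb) (act_gr _ va)) !lact_gabs -!Defs.actM.
(* By definition of [tract], [gp (b ^ x)] cancels against [gabs (b ^ x)]. *)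
have e : (tract C b x * gabs C (b ^ x) = gabs C b * x)%g.
  by rewrite /tract /gabs; move: (gp C b) (gp C (b ^ x)%g) => g h; rewrite mulgK.
rewrite -conjgM e conjgM tractE; congr (tv (dact _ _ _) _).
by move: (mp C _) (mp C _) => r s; rewrite -!mulgA mulKg.
Qed.

Lemma braid_mor (V W : dobj k X) :
  @is_mor k X (V *o W) (W *o V) (braid C V W).
Proof.
split=> [c u|]; last exact: braid_act.
have /subvP h : (tgr C V W c <= braid C V W @^-1: tgr C W V c)%VS.
  apply: tgr_sub => a b v w ab va wb.
  rewrite -memv_preim (braidE C va wb) lact_gabs -ab -circ_braid.
  by apply: mem_tgr; apply: act_gr.
by move=> /h; rewrite -memv_preim.
Qed.

Lemma tensD_ext (V : dobj k X) (U : vectType k) (f g : 'Hom(tens V D, U)) :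
  (forall a v y x, v \in gr V a ->
     f (tv v (Del k y x)) = g (tv v (Del k y x))) ->
  f = g.
Proof.
move=> fg; apply: glift_ext => a b v d va _.
have [h hE] := @tv_linr k V D v.
rewrite -hE -!comp_lfunE; congr (fun_of_lfun _ _).
by apply: D_ext => y x; rewrite !comp_lfunE hE; apply: fg va.
Qed.

Lemma alpha_natural (V W : dobj k X) (f : 'Hom(V, W)) :
  is_mor f -> (alpha C W \o tmap f \1 = f \o alpha C V)%VF.
Proof.
move=> [fgr fact]; apply: tensD_ext => a v y x va.
rewrite !comp_lfunE tmapE id_lfunE (alphaE _ _ _ va) (alphaE _ _ _ (fgr _ _ va)).
by rewrite linearZ /= fact.
Qed.

(** Naturality of [alpha] moves the braiding past the action, where it cancels
    with its inverse. *)
Lemma opposite_action (V W : dobj k X) :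
  ((braid C V W)^-1 \o alpha C (W *o V) \o tmap (braid C V W) \1)%VF =
  alpha C (V *o W).
Proof.
rewrite braid_inv -comp_lfunA (alpha_natural (braid_mor V W)).
by rewrite comp_lfunA braid_revK comp_lfun1l.
Qed.

End BraidMorphism.

(** * The regular object *)

Section Regular.
Variables (k : fieldType) (X : finGroupType).
Local Notation car := (Dcar k X).

(** The regular object has the same carrier as [D], with other grades and
    action: [Del k p g] has grade [p], and [X] translates [g]. Its grade spaces
    are images of the projections [Rproj], so that their properties reduce to
    identities of linear maps checked on the basis. *)
Definition Rproj (p : X) : 'End(car) :=
  dlift (fun y g => (y == p)%:R *: Del k y g).
Definition Rgr (p : X) : {vspace car} := limg (Rproj p).
Definition Ract (x : X) : 'End(car) :=
  dlift (fun p g => Del k (p ^ x)%g (g * x)%g).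

Lemma Ract_el x p g : Ract x (Del k p g) = Del k (p ^ x)%g (g * x)%g.
Proof. exact: dliftE. Qed.

Lemma mem_Rgr p g : Del k p g \in Rgr p.
Proof.
have <- : Rproj p (Del k p g) = Del k p g by rewrite dliftE eqxx scale1r.
exact: memv_img (memvf _).
Qed.

Lemma Rgr_direct : direct_family Rgr.
Proof.
apply: (@directv_proj _ _ _ _ Rproj) => p q _ /memv_imgP[u _ ->].
have -> : (if p == q then Rproj q u else 0) = ((p == q)%:R *: Rproj q)%VF u.
  by rewrite scale_lfunE; case: eqP; rewrite ?scale1r ?scale0r.
rewrite -comp_lfunE; congr (fun_of_lfun _ _); apply: D_ext => y g.
rewrite comp_lfunE scale_lfunE dliftE linearZ /= dliftE !scalerA -!natrM !mulnb.
by congr (_%:R *: _); case: (y =P q) => [->|_]; rewrite ?andbF // eq_sym andbT.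
Qed.

Lemma Rgr_full : (\sum_p Rgr p)%VS = fullv.
Proof.
apply/eqP; rewrite eqEsubv subvf; apply/subvP=> d _.
rewrite (D_span d); apply: rpred_sum => p _; apply: rpredZ.
have /subvP : (Rgr p.1 <= \sum_p Rgr p)%VS by exact: (sumv_sup p.1).
by apply; exact: mem_Rgr.
Qed.

Lemma Ract1 u : Ract 1%g u = u.
Proof.
rewrite -[RHS]id_lfunE; congr (fun_of_lfun _ _); apply: D_ext => p g.
by rewrite Ract_el id_lfunE conjg1 mulg1.
Qed.

Lemma RactM x y u : Ract (x * y)%g u = Ract y (Ract x u).
Proof.
rewrite -comp_lfunE; congr (fun_of_lfun _ _); apply: D_ext => p g.
by rewrite comp_lfunE !Ract_el conjgM mulgA.
Qed.

Lemma Ract_gr x p u : u \in Rgr p -> Ract x u \in Rgr (p ^ x)%g.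
Proof.
move=> /memv_imgP[w _ ->].
suff -> : Ract x (Rproj p w) = Rproj (p ^ x)%g (Ract x w).
  exact: memv_img (memvf _).
rewrite -!comp_lfunE; congr (fun_of_lfun _ _); apply: D_ext => y g.
rewrite !comp_lfunE Ract_el !dliftE linearZ /= Ract_el.
by rewrite (inj_eq (@conjg_inj _ x)).
Qed.

Definition Robj : dobj k X :=
  DObj Rgr_direct Rgr_full Ract1 RactM Ract_gr.

Lemma tensDel_hom (U : vectType k) (f : (X * X) * (X * X) -> U) :
  exists h : 'Hom(tens car car, U), forall p g q r,
    h (tv (Del k p g) (Del k q r)) = f ((p, g), (q, r)).
Proof.
pose b (d e : car) :=
  dlift (fun p g => dlift (fun q r => f ((p, g), (q, r))) e) d.
exists (tlift b) => p g q r; rewrite tliftE; first by rewrite /b !dliftE.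
split=> [e c d d' | d c e e']; first exact: linearP.
rewrite /b !(dlift_def _ d) scaler_sumr -big_split; apply: eq_bigr => s _ /=.
by rewrite linearP scalerDr !scalerA mulrC.
Qed.

Lemma tensDel_ext (U : vectType k) (f g : 'Hom(tens car car, U)) :
  (forall y x z t,
     f (tv (Del k y x) (Del k z t)) = g (tv (Del k y x) (Del k z t))) ->
  f = g.
Proof.
move=> fg; apply: tens_ext => d e.
have [h hE] := @tv_linl k car car e.
rewrite -hE -!comp_lfunE; congr (fun_of_lfun _ _); apply: D_ext => y x.
rewrite !comp_lfunE hE.
have [h' hE'] := @tv_linr k car car (Del k y x).
rewrite -hE' -!comp_lfunE; congr (fun_of_lfun _ _); apply: D_ext => z t.
by rewrite !comp_lfunE hE'.
Qed.

(** A map sending distinct basis vectors to distinct basis vectors has a left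
    inverse, obtained by sending each basis vector back along [invF] (to a
    preimage under the bijection [phi]). *)
Lemma tensDel_inj (F : 'Hom(tens car car, tens car car))
    (phi : (X * X) * (X * X) -> (X * X) * (X * X)) :
  injective phi ->
  (forall y x z t, let o := phi ((y, x), (z, t)) in
     F (tv (Del k y x) (Del k z t)) =
     tv (Del k o.1.1 o.1.2) (Del k o.2.1 o.2.2)) ->
  injective F.
Proof.
move=> phi_inj FE.
have [h hE] := tensDel_hom (fun o => let i := invF phi_inj o in
  tv (Del k i.1.1 i.1.2) (Del k i.2.1 i.2.2)).
suff hF : (h \o F = \1)%VF.
  by move=> u v uv; rewrite -[u]id_lfunE -[v]id_lfunE -hF !comp_lfunE uv.
apply: tensDel_ext => y x z t; rewrite comp_lfunE id_lfunE FE /= hE.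
by rewrite -!surjective_pairing invF_f.
Qed.

End Regular.

(** * Actions formed with a map determine it *)

Section Faithful.
Variables (k : fieldType) (X : finGroupType) (C : coset_data X).
Local Notation D := (Dobj k C).
Local Notation "V *o W" := (tobj C V W) (at level 40, left associativity).

(** All of [act_with] except its first arrow, which is the only one that depends
    on the map in question. *)
Definition act_core (V W : dobj k X) : 'Hom(V *o W *o (D *o D), V *o W) :=
  (tmap (alpha C V) (alpha C W)
   \o (assoc C V D (W *o D))^-1
   \o tmap \1 (assoc C D W D)
   \o tmap \1 (tmap (braid C W D) \1)
   \o tmap \1 (assoc C W D D)^-1
   \o assoc C V W (D *o D))%VF.

Lemma act_withE (Dp : 'Hom(D, D *o D)) (V W : dobj k X) u d :
  act_with Dp V W (tv u d) = act_core V W (tv u (Dp d)).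
Proof.
have -> : act_with Dp V W = (act_core V W \o tmap \1 Dp)%VF by [].
by rewrite comp_lfunE tmapE id_lfunE.
Qed.

Lemma mem_D y x : (Del k y x : D) \in gr D (Dgrade C y x).
Proof. exact: mem_Dgr. Qed.

(** Each arrow of the composite acts on homogeneous vectors by a group element;
    collecting these elements gives [leftExp], [innerExp] and [rightExp], and the
    two delta functions of [alpha] give the two conditions on the grades. *)
Lemma act_coreE (V W : dobj k X) p q y x z t (v : V) (w : W)
    (a := Dgrade C y x) (b := Dgrade C z t) :
  v \in gr V p -> w \in gr W q ->
  act_core V W (tv (tv v w) (tv (Del k y x) (Del k z t))) =
  ((p == movedPt C y z a b ^ (leftExp C z a b q)^-1) &&
   (q == z ^ (rightExp C a b)^-1))%g%:R *:
  tv (dact V (leftExp C z a b q * movedElt C x z a b)%g v)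
     (dact W (rightExp C a b * t)%g w).
Proof.
move=> vp wq.
have d1 : (Del k y x : D) \in gr D a by exact: mem_D.
have d2 : (Del k z t : D) \in gr D b by exact: mem_D.
have d12 : (tv (Del k y x) (Del k z t) : D *o D) \in gr (D *o D) (circ C a b).
  exact: mem_tgr.
rewrite /act_core !comp_lfunE (assocE C vp wq d12) tmapE id_lfunE.
rewrite !assoc_inv (assoc_revE C wq d1 d2) !(tmapE, id_lfunE).
have w1 := act_gr (tau C (mp C a) (mp C b))^-1%g wq.
rewrite (braidE C w1 d1) lact_gabs.
have w2 := act_gr (gabs C a) w1.
set q2 := ((q ^ _) ^ gabs C a)%g in w2 *.
rewrite (assocE C (act_gr (mp C q2)^-1%g d1) w2 d2).
rewrite -Defs.actM; set e := (_ * _)%g; have d1e := act_gr e d1.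
have w2z : (tv (dact W (gabs C a) (dact W (tau C (mp C a) (mp C b))^-1 w))
    (Del k z t) : W *o D)%g \in gr (W *o D) (circ C q2 b) by exact: mem_tgr.
rewrite (assoc_revE C (act_gr _ vp) d1e w2z) tmapE (alphaE C _ _ w2).
have q2E : q2 = (q ^ rightExp C a b)%g by rewrite conjgM.
have -> : (q == z ^ (rightExp C a b)^-1)%g = (z == q2).
  by rewrite q2E; apply/eqP/eqP=> ->; rewrite ?conjgKV ?conjgK.
(* If [q2] differs from [z] both sides vanish; otherwise [q2] may be replaced
   by [z], which brings the exponents into the form of [innerExp]. *)
rewrite tvZr; case: (eqVneq z q2) => [zq|_]; last by rewrite andbF !scale0r.
rewrite scale1r andbT {d1e}/e -zq -/(innerExp C z b).
rewrite [dact D _ _]Dact_el -/a -/(movedPt C y z a b) -/(movedElt C x z a b).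
rewrite (alphaE C _ _ (act_gr _ (act_gr _ vp))) tvZl -!Defs.actM.
rewrite -/(leftExp C z a b q) -conjgM -/(leftExp C z a b q).
congr ((nat_of_bool _)%:R *: tv (dact V _ v) (dact W _ w)).
- by apply/eqP/eqP=> ->; rewrite ?conjgKV ?conjgK.
- exact: mulgA.
- exact: mulgA.
Qed.

(** It contains one vector of each grade, so each delta function selects exactly
    one summand. *)
Definition Runit : Dcar k X := \sum_p Del k p 1%g.

Lemma act_core_unit y x z t
    (o := outQuad C y x z t (Dgrade C y x) (Dgrade C z t)) :
  act_core (Robj k X) (Robj k X)
    (tv (tv Runit Runit) (tv (Del k y x) (Del k z t))) =
  tv (Del k o.1.1 o.1.2) (Del k o.2.1 o.2.2).
Proof.
set a := Dgrade C y x; set b := Dgrade C z t.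
pose q0 := (z ^ (rightExp C a b)^-1)%g.
pose p0 := (movedPt C y z a b ^ (leftExp C z a b q0)^-1)%g.
have coreE p q := act_coreE y x z t
  (mem_Rgr k p 1%g : _ \in gr (Robj k X) p)
  (mem_Rgr k q 1%g : _ \in gr (Robj k X) q).
rewrite {2}/Runit tv_sumr tv_suml linear_sum (bigD1 q0) //=.
rewrite [X in _ + X]big1 => [|q ne]; last first.
  rewrite /Runit !tv_suml linear_sum big1 // => p _.
  by apply: etrans (coreE p q) _; rewrite (negbTE ne) andbF scale0r.
rewrite addr0 /Runit !tv_suml linear_sum (bigD1 p0) //=.
rewrite big1 => [|p ne]; last first.
  by apply: etrans (coreE p q0) _; rewrite eqxx andbT (negbTE ne) scale0r.
rewrite addr0; apply: etrans (coreE p0 q0) _; rewrite !eqxx scale1r /=.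
by rewrite !Ract_el !mul1g; congr (tv (Del _ _ _) (Del _ _ _));
  rewrite conjgM conjgKV.
Qed.

Lemma act_with_inj (Dp Dq : 'Hom(D, D *o D)) :
  act_with Dp (Robj k X) (Robj k X) = act_with Dq (Robj k X) (Robj k X) ->
  Dp = Dq.
Proof.
move=> pq; apply/lfunP=> d.
pose R := Robj k X.
have [h hE] := @tv_linr k (R *o R) (D *o D) (tv Runit Runit).
pose phi (i : (X * X) * (X * X)) := outQuad C i.1.1 i.1.2 i.2.1 i.2.2
  (Dgrade C i.1.1 i.1.2) (Dgrade C i.2.1 i.2.2).
have phi_inj : injective phi.
  move=> [[y x] [z t]] [[y' x'] [z' t']]; rewrite /phi /=.
  by apply: outQuad_inj; exact: Dgrade_circ.
have F_inj : injective (act_core R R \o h)%VF.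
  apply: (tensDel_inj phi_inj) => y x z t; rewrite comp_lfunE hE.
  exact: act_core_unit.
have e : act_core R R (tv (tv Runit Runit) (Dp d)) =
         act_core R R (tv (tv Runit Runit) (Dq d)).
  by rewrite -!act_withE pq.
by apply: F_inj; rewrite [LHS]comp_lfunE [RHS]comp_lfunE !hE; exact: e.
Qed.

End Faithful.

Theorem proposition4p4 (k : fieldType) (X : finGroupType) (C : coset_data X)
    (Delta : 'Hom(Dobj k C, tobj C (Dobj k C) (Dobj k C)))
    (hDelta : is_coproduct Delta)
    (Dop : 'Hom(Dobj k C, tobj C (Dobj k C) (Dobj k C))) :
  is_opposite_coproduct Delta Dop <-> Dop = Delta.
Proof.
have [Delta_mor DeltaE] := hDelta.
have opE (V W : dobj k X) :
    ((braid C V W)^-1 \o act_with Delta W V \o tmap (braid C V W) \1)%VF =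
    act_with Delta V W.
  by rewrite !DeltaE opposite_action.
split=> [[_ DopE]|->]; first by apply: act_with_inj; rewrite DopE opE.
by split=> // V W; rewrite opE.
Qed.
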